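(* For $\ell=1,2,\dots$, in the formal power series ring $\mathbb{Z}[t][[x_1,\dots,x_\ell]]$, \[ \sum_{\overline{a}\in\{0,1,2,\dots\}^\ell}{\sf Poin}(P_{\overline{a}},t)\,\mathbf{x}^{\overline{a}} =\frac{1}{1-\sum_{j=1}^{\ell}e_j(\mathbf{x})\,(t-1)(2t-1)\cdots((j-1)t-1)}, \] where $\mathbf{x}^{\overline{a}}=x_1^{a_1}\cdots x_\ell^{a_\ell}$ and $e_j(\mathbf{x})=\sum_{1\le i_1<\dots<i_j\le\ell}x_{i_1}\cdots x_{i_j}$ (for $j=1$ the product $(t-1)\cdots((j-1)t-1)$ is empty, equal to $1$).
   Context: For $\overline{a}=(a_1,\dots,a_\ell)$ with $n=\sum a_i$, $P_{\overline{a}}$ is the poset on $[n]$ which is a disjoint union of chains of sizes $a_1,\dots,a_\ell$ (no relations between distinct chains). For a poset $P$ on $[n]$: $H_{ij}=\{x\in\mathbb{R}^n:x_i=x_j\}$; $\mathcal{L}$ is the set of intersections of subsets of these hyperplanes (including $V=\mathbb{R}^n$), ordered by reverse inclusion, with Möbius function $\mu$; $\mathcal{K}_P=\{x:x_i<x_j\text{ whenever } i<_Pj\}$; $\mathcal{L}^{int}(\mathcal{K}_P)=\{X\in\mathcal{L}:X\cap\mathcal{K}_P\neq\emptyset\}$; ${\sf Poin}(P,t)=\sum_k c_k(P)t^k$ with $c_k(P)=\sum_{X\in\mathcal{L}^{int}(\mathcal{K}_P),\operatorname{codim}X=k}|\mu(V,X)|$ (for $n=0$, ${\sf Poin}=1$).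 *)

(* Defs.v *)
From HB Require Import structures.
From mathcomp Require Import all_boot all_order all_algebra.
From mathcomp Require Import boolp reals.

Set Implicit Arguments.
Unset Strict Implicit.
Unset Printing Implicit Defensive.

Import Order.TTheory GRing.Theory Num.Theory.
Local Open Scope ring_scope.

Section Mobius.
Context {d : Order.disp_t} {T : finPOrderType d}.
Implicit Types x y z : T.

(* [k] is fuel; the recursion is on [y], along chains of length at most #|T|. *)
Fixpoint mobius_rec (k : nat) x y : int :=
  if k is k'.+1
  then (x == y)%:R - \sum_(z | (x <= z)%O && (z < y)%O) mobius_rec k' x z
  else 0.

Definition mobius x y : int := mobius_rec #|T| x y.

Let down y := [set z | (z <= y)%O].

Let downS z y : (z < y)%O -> (#|down z| < #|down y|)%N.
Proof.
move=> zy; apply: proper_card; apply/properP; split.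
  by apply/subsetP => t; rewrite !inE => /le_lt_trans/(_ zy)/ltW.
by exists y; rewrite !inE // lt_geF.
Qed.

Let mobius_rec_fuel k m x y : (#|down y| <= k)%N -> (#|down y| <= m)%N ->
  mobius_rec k x y = mobius_rec m x y.
Proof.
elim: k m y => [|k IH] [|m] y //=.
- by rewrite leqn0 cards_eq0 => /eqP/setP/(_ y); rewrite !inE lexx.
- by move=> _; rewrite leqn0 cards_eq0 => /eqP/setP/(_ y); rewrite !inE lexx.
move=> yk ym; congr (_ - _); apply: eq_bigr => z /andP[_ /downS zy].
by apply: IH; rewrite -ltnS; apply: leq_trans zy _.
Qed.

Lemma mobiusE x y :
  mobius x y = (x == y)%:R - \sum_(z | (x <= z)%O && (z < y)%O) mobius x z.
Proof.
rewrite /mobius; have [k kT] : {k | #|T| = k.+1}.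
  by case: #|T| (max_card (mem [set x])) => [|k _]; [rewrite cards1 | exists k].
rewrite [in LHS]kT /=; congr (_ - _); apply: eq_bigr => z /andP[_ /downS zy].
have yT : (#|down y| <= #|T|)%N by apply: max_card.
by apply: mobius_rec_fuel; [rewrite -ltnS -kT|]; rewrite ?max_card //;
  apply: leq_trans zy _.
Qed.

Lemma mobius_id x : mobius x x = 1.
Proof.
rewrite mobiusE eqxx big1 ?subr0 // => z /andP[xz zx].
by have := le_lt_trans xz zx; rewrite ltxx.
Qed.

Lemma mobius_sum0 x y :
  (x < y)%O -> \sum_(z | (x <= z)%O && (z <= y)%O) mobius x z = 0.
Proof.
move=> xy; rewrite (bigD1 y) /=; last by rewrite lexx andbT ltW.
rewrite mobiusE lt_eqF // sub0r addrC; apply/eqP; rewrite subr_eq0; apply/eqP.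
by apply: eq_bigl => z; rewrite -andbA [(z < y)%O]lt_neqAle [_ && (_ != _)]andbC.
Qed.

End Mobius.

Section BraidArrangement.
Variables (R : realType) (n : nat).
Implicit Types (i j : 'I_n) (x : 'rV[R]_n).

Definition coord_diff i j x : R^o := x 0 i - x 0 j.

Lemma coord_diff_is_linear i j : linear (coord_diff i j).
Proof. by move=> a x y; rewrite /coord_diff !mxE scalerBr addrACA -opprD. Qed.

HB.instance Definition _ i j :=
  GRing.isLinear.Build R 'rV[R]_n R^o *:%R (coord_diff i j)
    (coord_diff_is_linear i j).

Definition hyperplane i j : {vspace 'rV[R]_n} := lker (linfun (coord_diff i j)).

Lemma mem_hyperplane i j x : (x \in hyperplane i j) = (x 0 i == x 0 j).
Proof. by rewrite memv_ker lfunE /= /coord_diff subr_eq0. Qed.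

Definition flat_seq : seq {vspace 'rV[R]_n} :=
  [seq (\bigcap_(p in H | (p.1 < p.2)%N) hyperplane p.1 p.2)%VS
     | H : {set 'I_n * 'I_n}].

Lemma fullv_flat : fullv \in flat_seq.
Proof.
by apply/imageP; exists set0 => //; rewrite big_pred0 // => p; rewrite inE.
Qed.

End BraidArrangement.

Definition flat (R : realType) (n : nat) : Type := seq_sub (flat_seq R n).

HB.instance Definition _ R n := Finite.on (flat R n).
HB.instance Definition _ R n := SubChoice.on (flat R n).

Fact flat_display : Order.disp_t. Proof. exact: Order.Disp tt tt. Qed.

Section FlatOrder.
Variables (R : realType) (n : nat).
Implicit Types X Y Z : flat R n.

(* reverse inclusion *)
Definition flat_le X Y := (val Y <= val X)%VS.

Lemma flat_le_refl : reflexive flat_le.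
Proof. by move=> X; apply: subvv. Qed.

Lemma flat_le_anti : antisymmetric flat_le.
Proof.
move=> X Y /andP[YX XY]; apply: val_inj; apply/eqP.
by rewrite eqEsubv; apply/andP.
Qed.

Lemma flat_le_trans : transitive flat_le.
Proof. by move=> Y X Z YX ZY; apply: subv_trans ZY YX. Qed.

HB.instance Definition _ := Order.Le_isPOrder.Build flat_display (flat R n)
  flat_le_refl flat_le_anti flat_le_trans.

End FlatOrder.

Definition flatV (R : realType) n : flat R n := SeqSub (fullv_flat R n).

Definition codim (R : realType) n (X : flat R n) : nat := (n - \dim (val X))%N.

Record poset_on (n : nat) := PosetOn {
  plt :> rel 'I_n;
  plt_irr : irreflexive plt;
  plt_trans : transitive plt
}.

Definition cone (R : realType) n (P : poset_on n) (x : 'rV[R]_n) : Prop :=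
  forall i j, P i j -> x 0 i < x 0 j.

Definition interior_flat (R : realType) n (P : poset_on n) (X : flat R n) : Prop :=
  exists x, x \in val X /\ cone P x.

Definition poin_coef (R : realType) n (P : poset_on n) (k : nat) : int :=
  \sum_(X : flat R n | `[< interior_flat P X >] && (codim X == k))
     `|mobius (flatV R n) X|.

Definition Poin (R : realType) n (P : poset_on n) : {poly int} :=
  \poly_(k < n.+1) poin_coef R P k.

Section Chains.
Variables (l : nat) (a : 'I_l -> nat).

(* [tagnat.sig] is the increasing bijection from 'I_(\sum_i a i) onto the
   disjoint union of the 'I_(a i). *)
Definition chains_lt : rel 'I_(\sum_i a i) := fun u v =>
  (tagnat.sig1 u == tagnat.sig1 v) && (tagnat.sig2 u < tagnat.sig2 v)%N.

Lemma chains_irr : irreflexive chains_lt.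
Proof. by move=> u; rewrite /chains_lt ltnn andbF. Qed.

Lemma chains_trans : transitive chains_lt.
Proof.
move=> v u w /andP[/eqP uv ltuv] /andP[vw ltvw].
by apply/andP; split; [rewrite uv | apply: ltn_trans ltvw].
Qed.

Definition chains : poset_on (\sum_i a i) := PosetOn chains_irr chains_trans.

End Chains.

Section BoundedExponents.
Variable l : nat.
Implicit Types a b c : {ffun 'I_l -> nat}.

Definition subx a b : {ffun 'I_l -> nat} := [ffun i => (a i - b i)%N].

Definition below a : seq {ffun 'I_l -> nat} :=
  [seq [ffun i => val (b i)] | b : {dffun forall i : 'I_l, 'I_(a i).+1}].

Lemma mem_below a b : (b \in below a) = [forall i, b i <= a i]%N.
Proof.
apply/imageP/forallP => [[c _ ->] i | ba]; first by rewrite ffunE; have := ltn_ord (c i); rewrite ltnS.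
exists (finfun (fun i => Ordinal (ba i : (b i < (a i).+1)%N))) => //.
by apply/ffunP => i; rewrite !ffunE.
Qed.

Lemma below_uniq a : uniq (below a).
Proof.
rewrite map_inj_uniq ?enum_uniq // => b c /ffunP bc; apply/ffunP => i.
by apply: val_inj; have := bc i; rewrite !ffunE.
Qed.

Lemma belowP a b : reflect (forall i, b i <= a i)%N (b \in below a).
Proof. by rewrite mem_below; apply: forallP. Qed.

Lemma below_subK a b : b \in below a -> subx a (subx a b) = b.
Proof. by move/belowP=> ba; apply/ffunP => i; rewrite !ffunE subKn. Qed.

Lemma below_sub a b : subx a b \in below a.
Proof. by apply/belowP => i; rewrite ffunE leq_subr. Qed.

End BoundedExponents.

(* Formal power series in l variables over A, as families of coefficients. *)
Record mfps (l : nat) (A : comNzRingType) := MFps {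
  mcoef :> {ffun 'I_l -> nat} -> A
}.

Section MFpsRing.
Variables (l : nat) (A : comNzRingType).
Local Notation S := (mfps l A).
Local Notation expo := {ffun 'I_l -> nat}.
Implicit Types (f g h : S) (a b c : expo).

Lemma mfpsP f g : (forall a, f a = g a) -> f = g.
Proof. by case: f g => [f] [g] /= fg; congr MFps; apply: funext. Qed.

HB.instance Definition _ := gen_eqMixin S.
HB.instance Definition _ := gen_choiceMixin S.

Definition mfps_zero : S := MFps (fun=> 0).
Definition mfps_opp f : S := MFps (fun a => - f a).
Definition mfps_add f g : S := MFps (fun a => f a + g a).
Definition mfpsC (c : A) : S := MFps (fun a => if a == 0 then c else 0).
Definition mfps_mul f g : S :=
  MFps (fun a => \sum_(b <- below a) f b * g (subx a b)).

Lemma mfps_addA : associative mfps_add.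
Proof. by move=> f g h; apply: mfpsP => a /=; rewrite addrA. Qed.
Lemma mfps_addC : commutative mfps_add.
Proof. by move=> f g; apply: mfpsP => a /=; rewrite addrC. Qed.
Lemma mfps_add0 : left_id mfps_zero mfps_add.
Proof. by move=> f; apply: mfpsP => a /=; rewrite add0r. Qed.
Lemma mfps_addN : left_inverse mfps_zero mfps_opp mfps_add.
Proof. by move=> f; apply: mfpsP => a /=; rewrite addNr. Qed.

HB.instance Definition _ :=
  GRing.isZmodule.Build S mfps_addA mfps_addC mfps_add0 mfps_addN.

Lemma mfps_mulC : commutative mfps_mul.
Proof.
move=> f g; apply: mfpsP => a /=.
have pa : perm_eq (below a) [seq subx a b | b <- below a].
  apply: uniq_perm; first exact: below_uniq.
    rewrite map_inj_in_uniq ?below_uniq // => b c ba ca e.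
    by rewrite -(below_subK ba) e below_subK.
  move=> b; apply/idP/mapP => [ba|[c _ ->]]; last exact: below_sub.
  by exists (subx a b); rewrite ?below_sub ?below_subK.
rewrite (perm_big _ pa) big_map /= big_seq [RHS]big_seq.
by apply: eq_bigr => b ba; rewrite below_subK // mulrC.
Qed.

Lemma mfps_mulA : associative mfps_mul.
Proof.
move=> f g h; apply: mfpsP => a /=; apply/esym.
under eq_big_seq => b ba.
  rewrite mulr_suml.
  have pb : perm_eq (below b) [seq c <- below a | c \in below b].
    apply: uniq_perm; rewrite ?filter_uniq ?below_uniq // => c.
    rewrite mem_filter; case: (boolP (c \in below b)) => //= /belowP cb.
    by apply/esym/belowP => i; apply: leq_trans (cb i) (belowP _ _ ba i).
  rewrite (perm_big _ pb) big_filter.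
  over.
rewrite (exchange_big_dep xpredT) //=; apply: eq_big_seq => c ca.
rewrite mulr_sumr -big_filter.
have pc : perm_eq [seq b <- below a | c \in below b]
                  [seq c + d | d <- below (subx a c)].
  apply: uniq_perm; rewrite ?filter_uniq ?below_uniq //.
    by rewrite map_inj_uniq ?below_uniq // => x y /ffunP xy; apply/ffunP => i;
      have := xy i; rewrite !ffunE => /addnI.
  move=> b; rewrite mem_filter; apply/andP/mapP => [[/belowP cb /belowP ba]|].
    exists (subx b c); first by apply/belowP => i; rewrite !ffunE leq_sub2r.
    by apply/ffunP => i; rewrite !ffunE; apply/esym/(subnKC (cb i)).
  move=> [x /belowP xa ->]; split; apply/belowP => i; rewrite ffunE.
    exact: leq_addr.
  by have := xa i; rewrite ffunE leq_subRL // (belowP _ _ ca).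
rewrite (perm_big _ pc) big_map; apply: eq_bigr => x _.
by rewrite mulrA; congr (f c * g _ * h _); apply/ffunP => i;
  rewrite !ffunE ?addKn ?subnDA.
Qed.

Lemma mfps_mul1 : left_id (mfpsC 1) mfps_mul.
Proof.
move=> f; apply: mfpsP => a /=.
have a0 : 0 \in below a by apply/belowP => i; rewrite ffunE.
rewrite (bigD1_seq 0) ?below_uniq //= eqxx mul1r big1 ?addr0.
  by congr (f _); apply/ffunP => i; rewrite !ffunE subn0.
by move=> b /negPf ->; rewrite mul0r.
Qed.

Lemma mfps_mulD : left_distributive mfps_mul mfps_add.
Proof.
move=> f g h; apply: mfpsP => a /=; rewrite -big_split /=.
by apply: eq_bigr => b _; rewrite mulrDl.
Qed.

Lemma mfps_one_neq0 : mfpsC 1 != 0.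
Proof.
apply/eqP => /(congr1 (fun f : S => f 0)) /=; rewrite eqxx => /eqP.
by rewrite oner_eq0.
Qed.

HB.instance Definition _ := GRing.Zmodule_isComNzRing.Build S
  mfps_mulA mfps_mulC mfps_mul1 mfps_mulD mfps_one_neq0.

Definition mfps_unit : {pred S} := fun f => `[< exists g, g * f = 1 >].

Definition mfps_inv f : S :=
  if pselect (exists g, g * f = 1) is left e then sval (cid e) else f.

Lemma mfps_mulV : {in mfps_unit, left_inverse 1 mfps_inv *%R}.
Proof.
move=> f /asboolP fU; rewrite /mfps_inv; case: pselect => // e.
exact: svalP (cid e).
Qed.

Lemma mfps_unitPl f g : g * f = 1 -> mfps_unit f.
Proof. by move=> gf; apply/asboolP; exists g. Qed.

Lemma mfps_inv_out : {in [predC mfps_unit], mfps_inv =1 id}.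
Proof.
move=> f /= /negP fU; rewrite /mfps_inv; case: pselect => // e.
by case: fU; apply/asboolP.
Qed.

HB.instance Definition _ := GRing.ComNzRing_hasMulInverse.Build S
  mfps_mulV mfps_unitPl mfps_inv_out.

Definition mfpsX (i : 'I_l) : S :=
  MFps (fun a => (a == [ffun j => nat_of_bool (j == i)])%:R).

Definition mfps_esym (j : nat) : S :=
  \sum_(I : {set 'I_l} | #|I| == j) \prod_(i in I) mfpsX i.

End MFpsRing.

Arguments mfpsC {l A} c.
Arguments mfps_esym l A j : clear implicits.

(* Main.v *)
(* Each |mu(V, X)| counts the permutations w whose fixed space is X, so Poin(P,
   t) is the sum of t^(n - cyc w) over the "P-transverse" permutations, those
   whose fixed space meets the cone.  On the other side, the product
   (-1)(t-1)...((j-1)t-1) is the sum of (-1)^(cyc u) t^(j - cyc u) over the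
   permutations u of a j-set.  Hence the coefficient of x^a in the product of
   the Poincare series with the denominator is a signed sum over pairs (u, v), u
   a permutation of a set B of top elements of the chains and v a transverse
   permutation of what remains; gluing them gives a transverse permutation w
   with a w-stable set B of maximal elements.  For a <> 0 some cycle of w
   consists of maximal elements (take the level set of the largest coordinate of
   a point of the cone fixed by w), and adding it to B or removing it from B
   cancels all terms. *)

Require Import Defs.
From HB Require Import structures.
From mathcomp Require Import all_boot all_order all_algebra all_fingroup.
From mathcomp Require Import boolp reals.

Set Implicit Arguments.
Unset Strict Implicit.
Unset Printing Implicit Defensive.

Import Order.TTheory GRing.Theory Num.Theory.
Local Open Scope ring_scope.

(** * Reflection length of permutations, and induction along transpositions *)

Section ReflectionLength.
Variable T : finType.
Implicit Types (u v w : {perm T}) (x y z : T) (A B C S : {set T}).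
Local Open Scope group_scope.

(* The least number of transpositions with product [w]. *)
Definition rlen w : nat := #|T| - #|porbits w|.

Lemma card_porbits_le w : (#|porbits w| <= #|T|)%N.
Proof. exact: leq_imset_card. Qed.

Lemma odd_rlen w : odd (rlen w) = w.
Proof. by rewrite oddB ?card_porbits_le. Qed.

Lemma porbit_fixed w x : w x = x -> porbit w x = [set x].
Proof.
move=> wx; apply/setP => z; rewrite inE; apply/porbitP/eqP => [[i ->]|->].
  by elim: i => [|i IH]; rewrite ?perm1 // expgSr permM IH.
by exists 0%N; rewrite perm1.
Qed.

Lemma rlen1 : rlen 1 = 0%N.
Proof.
rewrite /rlen card_imset ?subnn // => x y.
by rewrite !porbit_fixed ?perm1 // => /set1_inj.
Qed.

(** As [u] fixes [z], the orbit of [z] is a singleton; the transposition merges it into the orbit of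
    [y], so exactly one orbit is lost. *)
Lemma rlen_tperm z y u : u z = z -> z != y ->
  rlen (tperm z y * u) = (rlen u).+1.
Proof.
move=> uz zy; have := porbits_mul_tperm u z y; rewrite /= zy.
have -> : (z \notin porbit u y) = true.
  by rewrite porbit_sym porbit_fixed // inE eq_sym.
have := card_porbits_le u; have := card_porbits_le (tperm z y * u).
rewrite /rlen addn2 addn1 => _ + [E]; rewrite -E => lt.
by rewrite subnS prednK ?subn_gt0.
Qed.

(** Induction on the number of moved points: if [u] moves [z] and sends [y] to [z], then
    [tperm z y * u] fixes [z] as well as every point that [u] fixes. *)
Lemma perm_on_ind S (P : {perm T} -> Prop) :
    P 1 ->
    (forall z y u, z \in S -> y \in S -> z != y -> u z = z -> perm_on S u ->
       P u -> P (tperm z y * u)) ->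
  forall u, perm_on S u -> P u.
Proof.
move=> P1 Pt u; have [m] := ubnP #|[set x | u x != x]|.
elim: m u => // m IH u; rewrite ltnS => um Su.
have [z uz|u1] := pickP (fun z => u z != z); last first.
  suff -> : u = 1 by [].
  by apply/permP => x; rewrite perm1; apply/eqP/negbFE/u1.
set y := u^-1 z; have uy : u y = z by rewrite permKV.
have zy : z != y by apply: contra uz => /eqP zy; rewrite {1}zy uy.
have zS : z \in S by apply: contraR uz => /(out_perm Su) ->.
have yS : y \in S by rewrite -(perm_closed _ Su) uy.
have Su' : perm_on S (tperm z y * u).
  apply: perm_onM => //; apply: subset_trans (tperm_on z y) _.
  by apply/subsetP => x; rewrite !inE => /orP[] /eqP ->.
have -> : u = tperm z y * (tperm z y * u) by rewrite mulgA tperm2 mul1g.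
apply: Pt => //; first by rewrite permM tpermL.
apply: IH => //; apply: leq_trans um; apply: proper_card; apply/properP; split.
  apply/subsetP => x; rewrite !inE permM; apply: contra => /eqP ux.
  rewrite tpermD ?ux //; first by apply: contra uz => /eqP->; rewrite ux.
  by apply: contra zy => /eqP yx; rewrite -uy yx ux.
by exists z; rewrite !inE ?uz // permM tpermL uy eqxx.
Qed.

(** The transpositions of [u] are stripped one by one; [v] fixes each [z] in [S], so [rlen_tperm]
    applies with and without the factor [v]. *)
Lemma rlenM S u v : perm_on S u -> perm_on (~: S) v ->
  rlen (u * v) = (rlen u + rlen v)%N.
Proof.
move=> Su Sv; elim/(@perm_on_ind S): u / Su => [|z y u zS yS zy uz _ IH].
  by rewrite mul1g rlen1.
rewrite -mulgA !rlen_tperm ?IH // permM uz.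
by apply: (out_perm Sv); rewrite inE zS.
Qed.

(** The restriction has the orbit [C] and otherwise only singletons outside [C]. *)
Lemma rlen_cycle w x : rlen (restr_perm (porbit w x) w) = #|porbit w x|.-1.
Proof.
set C := porbit w x; set u := restr_perm C w.
have wC : w \in 'N(C | 'P).
  apply/astabsP => y; rewrite /= apermE /C -!eq_porbit_mem.
  by rewrite (porbit_perm w 1 y).
have uC y : y \in C -> porbit u y = C.
  move=> yC; have uX i : (u ^+ i) y = (w ^+ i) y.
    elim: i => [|i IH]; first by rewrite !expg0.
    rewrite !expgSr !permM IH restr_permE //.
    by rewrite /C -eq_porbit_mem porbit_perm eq_porbit_mem.
  apply/setP => z; rewrite /C -(eqP (_ : porbit w y == porbit w x)).
    by apply/porbitP/porbitP => -[i ->]; exists i; rewrite uX.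
  by rewrite eq_porbit_mem -/C.
have uD y : y \notin C -> porbit u y = [set y].
  by move=> yC; rewrite porbit_fixed // (out_perm (restr_perm_on _ _)).
rewrite /rlen.
have -> : porbits u = C |: [set [set y] | y in ~: C].
  apply/setP => D; rewrite in_setU1; apply/imsetP/orP => [[y _ ->]|[/eqP->|]].
  - have [/uC->|yC] := boolP (y \in C); first by left.
    by right; rewrite uD //; apply/imsetP; exists y; rewrite ?inE.
  - by exists x; rewrite // uC // /C porbit_id.
  - by case/imsetP=> y; rewrite inE => yC ->; exists y; rewrite // uD.
rewrite cardsU1 card_imset; last exact: set1_inj.
have -> : C \notin [set [set y] | y in ~: C].
  apply/imsetP => -[y]; rewrite inE => /negP yC CE; apply: yC.
  by rewrite CE set11.
by rewrite -(cardsC C) add1n subnS addnK.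
Qed.

End ReflectionLength.

(** * The product of linear factors as a signed sum over permutations *)

Section SignedCycleSum.
Variable T : finType.
Implicit Types (u v w : {perm T}) (x y z : T) (A B C S : {set T}).

(** The index [y] is the preimage of [z] under [u]; multiplying by [tperm z y] turns [z] into a
    fixed point, and [y = z] is the case where it already was one. *)
Lemma sum_perm_onD1 (V : nmodType) (F : {perm T} -> V) B z : z \in B ->
  \sum_(u | perm_on B u) F u =
  \sum_(y in B) \sum_(v | perm_on (B :\ z) v) F (tperm z y * v)%g.
Proof.
move=> zB; rewrite pair_big_dep /=.
pose h (p : T * {perm T}) := (tperm z p.1 * p.2)%g.
pose h' u := ((u^-1)%g z, (tperm z ((u^-1)%g z) * u)%g).
rewrite (reindex_onto h h') => [|u _]; last by rewrite /h /= mulgA tperm2 mul1g.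
apply: eq_bigl => -[y v]; rewrite /h' {1}/h /=.
have tB t : t \in B -> perm_on B (tperm z t).
  move=> tB; apply: subset_trans (tperm_on z t) _.
  by apply/subsetP => x; rewrite !inE => /orP[] /eqP ->.
apply/andP/andP => [[Bu /eqP[yE vE]]|[yB Bv]].
  have yB : y \in B.
    by rewrite -yE; rewrite (perm_closed _ (perm_onV Bu)).
  have Bv : perm_on B v.
    rewrite -[v]mul1g -(tperm2 z y) -mulgA.
    exact: perm_onM (tB y yB) Bu.
  have vz : v z = z.
    have : h (y, v) y = z by rewrite -[in RHS](permKV (h (y, v)) z) yE.
    by rewrite /h /= permM tpermR.
  split=> //; apply/subsetP => x; rewrite !inE => vx.
  rewrite (subsetP Bv) ?inE // andbT; apply: contra vx => /eqP ->.
  by rewrite vz.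
have vz : v z = z by apply: (out_perm Bv); rewrite !inE eqxx.
have yE : (h (y, v))^-1%g z = y.
  by apply: (canLR (permK _)); rewrite /h /= permM tpermR.
split; last by rewrite yE /h /= mulgA tperm2 mul1g.
apply: perm_onM (tB y yB) _; apply: subset_trans Bv _; exact: subsetDl.
Qed.

(** For [u] supported in [B], the two signs combine to -1 raised to the number of cycles of [u] on
    [B], fixed points included. *)
Definition signed_weight B u : {poly int} :=
  (-1) ^+ #|B| * (-1) ^+ odd_perm u * 'X^(rlen u).

(** With [z] removed from a set of size m + 1, either [z] is fixed and forms one more cycle (factor
    -1), or it is inserted next to one of the m other points, which keeps the sign and adds 1 to
    [rlen] (total m ['X]). *)
Lemma sum_signed_weight B :
  \sum_(u | perm_on B u) signed_weight B u =
  \prod_(k < #|B|) (k%:R * 'X - 1).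
Proof.
have [m Bm] : {m | #|B| = m} by exists #|B|.
elim: m => [|m IH] in B Bm *; rewrite Bm.
  rewrite big_ord0 (big_pred1 1%g) => [|u /=].
    by rewrite /signed_weight Bm odd_perm1 rlen1 !expr0 !mulr1.
  apply/idP/eqP => [/perm_on_id|->]; last exact: perm_on1.
  by apply; rewrite Bm.
have [z zB] : exists z, z \in B by apply/card_gt0P; rewrite Bm.
have B'm : #|B :\ z| = m by move: Bm; rewrite (cardsD1 z) zB => -[].
rewrite (sum_perm_onD1 _ zB) big_ord_recr /=.
have := IH _ B'm; rewrite B'm => <-.
rewrite (big_setD1 z) //= mulrBr mulr1 addrC; congr (_ + _).
  rewrite (eq_bigr (fun=> 'X * \sum_(v | perm_on (B :\ z) v)
                                signed_weight (B :\ z) v)) => [|y].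
    by rewrite sumr_const B'm mulr_natl mulrnAr mulrC.
  rewrite !inE => /andP[yz yB].
  rewrite mulr_sumr; apply: eq_bigr => v Bv.
  have vz : v z = z by apply: (out_perm Bv); rewrite !inE eqxx.
  have zy : z != y by rewrite eq_sym.
  rewrite /signed_weight rlen_tperm // odd_mul_tperm zy signr_addb Bm B'm.
  by rewrite expr1 !exprS !mulN1r mulrNN mulrCA.
rewrite tperm1 -sumrN; apply: eq_bigr => v _.
by rewrite mul1g /signed_weight Bm B'm exprS !mulN1r !mulNr.
Qed.

End SignedCycleSum.

(** * Transverse permutations and the sign-reversing cancellation *)

Section TransverseSum.
Variables (R : realDomainType) (T : finType) (lt : rel T).
Implicit Types (u v w : {perm T}) (s t : T) (A B C : {set T}).

(** Only relations inside [A] are imposed, so deleting elements of the poset does not change the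
    type on which permutations act. *)
Definition transverse A w : Prop :=
  exists x : T -> R, (forall t, x (w t) = x t) /\
                     {in A &, forall s t, lt s t -> x s < x t}.

Definition transverse_sum A : {poly int} :=
  \sum_(w | perm_on A w && `[< transverse A w >]) 'X^(rlen w).

Definition maximals A := [set t in A | [forall s in A, ~~ lt t s]].

Lemma maximalsP A t s : t \in maximals A -> s \in A -> ~~ lt t s.
Proof. by rewrite inE => /andP[_ /forall_inP]; apply. Qed.

(** Raising all of [B] to one common value above every [x t] is invariant under [u], and respects
    the order because nothing in [A] lies above an element of [B]. *)
Lemma transverseM A B u v : B \subset maximals A -> perm_on B u ->
  perm_on (A :\: B) v -> transverse (A :\: B) v -> transverse A (u * v)%g.
Proof.
move=> BM Bu Bv [x [xv xlt]].
pose M := 1 + \sum_t `|x t|.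
have xM t : x t < M.
  apply: le_lt_trans (ler_norm _) _; rewrite /M (bigD1 t) //= addrCA ltrDl.
  by rewrite ltr_pwDl ?ltr01 ?sumr_ge0.
exists (fun t => if t \in B then M else x t); split=> [t|s t sA tA st].
  rewrite permM; have [tB|tB] := boolP (t \in B).
    have utB : u t \in B by rewrite (perm_closed _ Bu).
    by rewrite (out_perm Bv) ?utB // !inE utB.
  rewrite (out_perm Bu) // ifN ?xv //; apply: contra tB => vtB.
  by rewrite -(permK v t) (out_perm (perm_onV Bv)) ?inE ?vtB.
have sB : s \notin B.
  by apply/negP => /(subsetP BM) /maximalsP/(_ tA); rewrite st.
rewrite (negbTE sB); case: ifP => // tB.
by apply: xlt; rewrite ?inE ?sB ?tB.
Qed.

(** The quotient [v] is the identity on [B] and agrees with [w] elsewhere, so the same point [x]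
    serves for both. *)
Lemma transverse_split A B w : B \subset A -> w \in ('N(B | 'P))%g ->
  perm_on A w -> transverse A w ->
  let v := ((restr_perm B w)^-1 * w)%g in
  perm_on (A :\: B) v /\ transverse (A :\: B) v.
Proof.
move=> BA wB Aw [x [xw xlt]] v.
have vB t : t \in B -> v t = t.
  move=> tB; rewrite permM -(restr_permE wB) ?permKV //.
  by rewrite (perm_closed _ (perm_onV (restr_perm_on _ _))).
have vNB t : t \notin B -> v t = w t.
  by move=> tB; rewrite permM (out_perm (perm_onV (restr_perm_on _ _))).
split.
  apply/subsetP => t; rewrite !inE; apply: contraR; rewrite negb_and negbK.
  have [/vB->|tB] := boolP (t \in B); first by rewrite eqxx.
  by move=> /= tA; rewrite vNB // (out_perm Aw).
exists x; split=> [t|s t].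
  by have [/vB->|/vNB->] := boolP (t \in B).
by rewrite !inE => /andP[_ sA] /andP[_ tA]; apply: xlt.
Qed.

(* A transverse permutation [w] of [A] for which [B] is stable splits uniquely as
   a permutation of [B] times a transverse permutation of [A :\: B]. *)
Lemma sum_transverseD A B : B \subset maximals A ->
  (\prod_(k < #|B|) (k%:R * 'X - 1)) * transverse_sum (A :\: B) =
  \sum_(w | (perm_on A w && `[< transverse A w >]) && (w \in ('N(B | 'P))%g))
     (-1) ^+ #|B| * (-1) ^+ odd_perm (restr_perm B w) * 'X^(rlen w).
Proof.
move=> BM; have BA : B \subset A.
  by apply: subset_trans BM _; apply/subsetP => t; rewrite inE => /andP[].
rewrite -sum_signed_weight big_distrlr /= pair_big_dep /=.
pose h (p : {perm T} * {perm T}) := (p.1 * p.2)%g.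
pose h' w := (restr_perm B w, ((restr_perm B w)^-1 * w)%g).
rewrite [RHS](reindex_onto h h') => [|w _]; last by rewrite /h /= mulKVg.
(* The left factor is recovered from the product as its restriction to [B], which makes [h] and [h']
   mutually inverse. *)
have restrK u v : perm_on B u -> perm_on (A :\: B) v ->
    (u * v)%g \in ('N(B | 'P))%g /\ restr_perm B (u * v)%g = u.
  move=> Bu Bv.
  have uvN : (u * v)%g \in ('N(B | 'P))%g.
    apply/astabsP => t; rewrite /= apermE permM.
    have [tB|tB] := boolP (t \in B).
      by rewrite (out_perm Bv) ?inE (perm_closed _ Bu) tB.
    rewrite (out_perm Bu) //; apply: contraNF tB => vtB.
    by rewrite -(permK v t) (out_perm (perm_onV Bv)) ?inE ?vtB.
  split=> //; apply/permP => t; have [tB|tB] := boolP (t \in B).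
    by rewrite restr_permE // permM (out_perm Bv) // !inE (perm_closed _ Bu) tB.
  by rewrite (out_perm (restr_perm_on _ _)) // (out_perm Bu).
apply: eq_big => [[u v]|[u v] /= /andP[Bu /andP[Bv _]]]; last first.
  rewrite /h /= /signed_weight (proj2 (restrK _ _ Bu Bv)).
  rewrite -[LHS]mulrA -(exprD 'X).
  rewrite (rlenM Bu) //; apply: subset_trans Bv _.
  by apply/subsetP => t; rewrite !inE => /andP[].
rewrite /h' /h /=.
apply/and3P/andP => [[Bu Bv /asboolP tv]|[/andP[/andP[Auv /asboolP tuv] uvN]]].
  have [uvN ruv] := restrK _ _ Bu Bv.
  rewrite uvN ruv mulKg eqxx andbT; split=> //; apply/andP; split.
    apply: perm_onM; first by apply: subset_trans Bu _.
    by apply: subset_trans Bv _; apply: subsetDl.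
  by apply/asboolP; apply: transverseM tv.
have [] := transverse_split BA uvN Auv tuv.
move=> Bv tv /eqP[uE vE]; rewrite uE mulKg in Bv tv.
by split=> //; [rewrite -uE; apply: restr_perm_on | apply/asboolP].
Qed.

(** Take [t] in [A] where [x] is largest: [x] is constant on its orbit, and an element of [A] above
    a point of this orbit would have a larger value. *)
Lemma maximal_orbit A w : A != set0 -> perm_on A w -> transverse A w ->
  exists2 t, t \in A & porbit w t \subset maximals A.
Proof.
case/set0Pn=> t0 t0A Aw [x [xw xlt]].
have [t tA tmax] := @arg_maxP _ _ _ t0 (mem A) x t0A.
exists t => //; apply/subsetP => s /porbitP[i ->{s}].
have xi : x ((w ^+ i)%g t) = x t.
  by elim: i => [|i IH]; rewrite ?perm1 // expgSr permM xw.
rewrite inE; apply/andP; split.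
  elim: i {xi} => [|i IH]; first by rewrite perm1.
  by rewrite expgSr permM (perm_closed _ Aw).
apply/forall_inP => s sA; apply/negP => ts.
have si : (w ^+ i)%g t \in A.
  elim: i {xi ts} => [|i IH]; first by rewrite perm1.
  by rewrite expgSr permM (perm_closed _ Aw).
have := xlt _ _ si sA ts; rewrite xi ltNge => /negP[].
exact: tmax.
Qed.

(* Toggling the orbit of [t] in [B] changes the number of cycles of [w] in [B]
   by one. *)
Lemma sum_stable_sign0 A w t : porbit w t \subset A ->
  \sum_(B : {set T} | (B \subset A) && (w \in ('N(B | 'P))%g))
     (-1) ^+ #|B| * (-1) ^+ odd_perm (restr_perm B w) = 0 :> {poly int}.
Proof.
set C := porbit w t => CA.
have memC B s : w \in ('N(B | 'P))%g -> s \in C -> (s \in B) = (t \in B).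
  move=> /astabsP wB /porbitP[i ->]; elim: i => [|i IH]; first by rewrite perm1.
  by rewrite expgSr permM; have := wB ((w ^+ i)%g t); rewrite /= apermE => ->.
have wC : w \in ('N(C | 'P))%g.
  apply/astabsP => y; rewrite /= apermE /C -!eq_porbit_mem.
  by rewrite (porbit_perm w 1 y).
have tC : t \in C by apply: porbit_id.
rewrite (bigID (fun B : {set T} => t \in B)) /=.
(* A [w]-stable set contains all of [C] or none of it, so the stable sets containing [t] are the
   [B :|: C] with [B] stable and avoiding [t]. *)
rewrite (reindex_onto (fun B => B :|: C) (fun B => B :\: C)) /=; last first.
  move=> B /andP[/andP[_ wB] tB]; apply/setP => s; rewrite !inE.
  by case: (boolP (s \in C)) => sC; rewrite ?orbF // (memC B) // tB.
have predE (B : {set T}) :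
    [&& (B :|: C \subset A) && (w \in ('N(B :|: C | 'P))%g), t \in B :|: C
      & (B :|: C) :\: C == B] =
    ((B \subset A) && (w \in ('N(B | 'P))%g)) && (t \notin B).
  rewrite subUset CA andbT in_setU tC orbT /=.
  apply/andP/andP => [[/andP[BA wBC] /eqP BE]|[/andP[BA wB] tB]].
    have tB : t \notin B by rewrite -BE !inE tC.
    split=> //; apply/andP; split=> //; apply/astabsP => s; rewrite -BE !inE.
    have /= := astabsP wC s; have /= := astabsP wBC s; rewrite !apermE !inE.
    by move=> -> ->.
  split.
    rewrite BA; apply/astabsP => s; rewrite !inE.
    by rewrite (astabsP wC) (astabsP wB).
  apply/eqP/setP => s; rewrite !inE.
  case: (boolP (s \in C)) => sC; rewrite ?orbF //=.
  by rewrite (memC B) // (negbTE tB).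
under eq_bigl => B do rewrite -andbA predE.
rewrite -big_split big1 //= => B /andP[/andP[BA wB] tB].
have BC0 : [disjoint B & C].
  rewrite disjoint_sym; apply/pred0P => s /=; apply/negP => /andP[sC].
  by rewrite (memC B) // (negbTE tB).
have -> : #|B :|: C| = (#|B| + #|C|)%N.
  by rewrite cardsU (eqP (_ : B :&: C == set0)) ?cards0 ?subn0 // setI_eq0.
have -> : restr_perm (B :|: C) w = (restr_perm B w * restr_perm C w)%g.
  have wBC : w \in ('N(B :|: C | 'P))%g.
    by apply/astabsP => s; rewrite !inE (astabsP wC) (astabsP wB).
  apply/permP => s; rewrite permM; have [sB|sB] := boolP (s \in B).
    rewrite (restr_permE wBC) ?inE ?sB // (restr_permE wB) //.
    rewrite (out_perm (restr_perm_on _ _)) //; apply: contraTN tB => wsC.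
    by rewrite negbK -(memC B _ wB wsC) (astabsP wB).
  rewrite (out_perm (restr_perm_on B w)) //.
  have [sC|sC] := boolP (s \in C).
    by rewrite (restr_permE wBC) ?(restr_permE wC) // inE sC orbT.
  by rewrite !(out_perm (restr_perm_on _ _)) ?inE ?negb_or ?sB.
rewrite odd_permM signr_addb exprD mulrACA.
(* A cycle of length [#|C|] has sign of exponent [#|C| - 1], so the total exponent is odd. *)
have -> : (-1) ^+ #|C| * (-1) ^+ odd_perm (restr_perm C w) = -1 :> {poly int}.
  rewrite -odd_rlen rlen_cycle -/C signr_odd -exprD.
  have : (0 < #|C|)%N by apply/card_gt0P; exists t.
  by case: #|C| => // m _; rewrite /= addSn exprS -signr_odd oddD addbb mulr1.
by rewrite mulrN1 addNr.
Qed.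

(** After exchanging the sums, each transverse [w] has an orbit of maximal elements, and toggling
    that orbit kills the inner sum over stable [B]. *)
Lemma sum_transverse0 A : A != set0 ->
  \sum_(B : {set T} | B \subset maximals A)
     (\prod_(k < #|B|) (k%:R * 'X - 1)) * transverse_sum (A :\: B) = 0.
Proof.
move=> A0; rewrite (eq_bigr _ (fun B BM => sum_transverseD BM)).
rewrite (exchange_big_dep (fun w => perm_on A w && `[< transverse A w >])) /=;
  last by move=> B w _ /andP[].
rewrite big1 // => w /[dup] /andP[Aw /asboolP tw] wP.
have [t _ tM] := maximal_orbit A0 Aw tw.
rewrite -mulr_suml; apply/eqP; rewrite mulf_eq0; apply/orP; left.
apply/eqP; rewrite -[RHS](sum_stable_sign0 tM); apply: eq_bigl => B.
by rewrite Aw (asboolT tw).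
Qed.

End TransverseSum.

(** * The Poincaré polynomial as a sum over transverse permutations *)

Section PoincarePolynomial.
Variables (R : realType) (n : nat).
Implicit Types (w u : {perm 'I_n}) (X Y Z : flat R n) (P : poset_on n).

Definition orbit_pairs w : {set 'I_n * 'I_n} :=
  [set p | p.2 \in porbit w p.1].

(** An intersection of hyperplanes, hence a flat by construction; [mem_fixspace] identifies it with
    the vectors fixed by [w]. *)
Definition fixspace w : {vspace 'rV[R]_n} :=
  (\bigcap_(p in orbit_pairs w | (p.1 < p.2)%N) hyperplane R p.1 p.2)%VS.

Lemma fixspace_flat w : fixspace w \in flat_seq R n.
Proof. by apply/imageP; exists (orbit_pairs w). Qed.

Definition fixflat w : flat R n := SeqSub (fixspace_flat w).

Lemma mem_bigcapv (I : finType) (Q : pred I) (U : I -> {vspace 'rV[R]_n}) x :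
  reflect (forall i, Q i -> x \in U i) (x \in (\bigcap_(i | Q i) U i)%VS).
Proof.
by rewrite memvE; apply: (iffP subv_bigcapP) => UP i /UP; rewrite memvE.
Qed.

Lemma mem_fixspace w (x : 'rV[R]_n) :
  reflect (forall i, x 0 (w i) = x 0 i) (x \in fixspace w).
Proof.
apply: (iffP (mem_bigcapv _ _ _)) => [xF i|xw [i j]] /=.
  have wi : w i \in porbit w i by apply: (mem_porbit w 1 i).
  have [lt|lt|/val_inj/esym->//] := ltngtP i (w i).
    by have := xF (i, w i); rewrite inE /= wi lt mem_hyperplane => /(_ isT)/eqP.
  have := xF (w i, i); rewrite inE /= porbit_sym wi lt mem_hyperplane.
  by move=> /(_ isT)/eqP.
rewrite inE mem_hyperplane /= => /andP[/porbitP[k ->] _]; apply/eqP.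
by elim: k => [|k IH]; rewrite ?perm1 // expgSr permM xw.
Qed.

Lemma fixspace_tperm z y u : u z = z -> z != y ->
  fixspace (tperm z y * u)%g = (fixspace u :&: hyperplane R z y)%VS.
Proof.
move=> uz zy; apply/vspaceP => x; rewrite memv_cap mem_hyperplane.
apply/mem_fixspace/andP => [xtu|[/mem_fixspace xu /eqP xzy] i].
  have xzy : x 0 z = x 0 y by have := xtu y; rewrite permM tpermR uz.
  split; last by rewrite xzy.
  apply/mem_fixspace => i; have := xtu i; rewrite permM.
  case: tpermP => [->|->|//]; rewrite ?uz //.
  by have := xtu z; rewrite permM tpermL => ->.
by rewrite permM xu; case: tpermP => [->|->|].
Qed.

(** Each transposition with [z] fixed by [u] cuts the fixed space by one hyperplane, which lowers
    the dimension by exactly 1. *)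
Lemma dim_fixspace w : (\dim (fixspace w) + rlen w)%N = n.
Proof.
have : perm_on setT w by apply/subsetP.
elim/(@perm_on_ind 'I_n setT): w / => [|z y u _ _ zy uz _ IH].
  have -> : fixspace 1 = fullv.
    apply/vspaceP => x; rewrite memvf; apply/mem_fixspace => i.
    by rewrite perm1.
  by rewrite rlen1 addn0 dimvf /dim /= mul1n.
rewrite rlen_tperm // fixspace_tperm // addnS -[RHS]IH -addSn.
congr (_ + _)%N; rewrite -(limg_ker_dim (linfun (coord_diff z y)) (fixspace u)).
rewrite -addn1; congr (_ + _)%N; apply/esym/eqP; rewrite eqn_leq.
apply/andP; split.
  have := dimvS (subvf (linfun (@coord_diff R n z y) @: fixspace u)).
  by rewrite dimvf.
rewrite lt0n dimv_eq0; apply/eqP => f0.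
(* This unit vector is fixed by [u] but lies off the hyperplane, so the cut is proper. *)
pose x : 'rV[R]_n := delta_mx 0 z.
have xu : x \in fixspace u.
  apply/mem_fixspace => i; rewrite !mxE /=.
  by rewrite -{1}uz (inj_eq perm_inj).
have := memv_img (linfun (coord_diff z y)) xu; rewrite f0 memv0 lfunE /=.
by rewrite /coord_diff !mxE !eqxx (eq_sym y) (negbTE zy) subr0 oner_eq0.
Qed.

Lemma codim_fixflat w : codim (fixflat w) = rlen w.
Proof. by rewrite /codim /= -{1}(dim_fixspace w) addKn. Qed.

Lemma fixflat_le w X :
  (fixflat w <= X)%O = (val X <= fixspace w)%VS.
Proof. by []. Qed.

Lemma flatV_le X : (flatV R n <= X)%O.
Proof. exact: subvf. Qed.

Lemma flat_lt_codim X Y : (X < Y)%O -> (codim X < codim Y)%N.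
Proof.
rewrite lt_neqAle => /andP[XY YX].
have dXY : (\dim (val Y) < \dim (val X))%N.
  rewrite ltn_neqAle dimvS // andbT; apply: contra XY => /eqP dXY.
  by rewrite -val_eqE eq_sym eqEdim dXY leqnn andbT.
rewrite /codim ltn_sub2l //; apply: leq_trans dXY _.
by have := dimvS (subvf (val X)); rewrite dimvf /dim /= mul1n.
Qed.

Lemma flat_sub_hyperplane X : X != flatV R n ->
  exists i j, i != j /\ (val X <= hyperplane R i j)%VS.
Proof.
move=> XV; have /imageP[H _ XE] := valP X.
have [[i j] /andP[ijH lt]|H0] :=
  pickP (fun p : 'I_n * 'I_n => (p \in H) && (p.1 < p.2)%N).
  exists i, j; split; first by rewrite neq_ltn lt.
  by rewrite XE (bigcapv_inf (i, j)) ?ijH.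
by case/eqP: XV; apply: val_inj; rewrite /= XE big_pred0.
Qed.

(* If [X] lies in the hyperplane [x_i = x_j] then multiplication by the
   transposition of [i] and [j] is a sign-reversing involution of the
   stabilizer of [X]. *)
Lemma sum_sign_stabilizer X :
  \sum_(w | (fixflat w <= X)%O) (-1) ^+ odd_perm w = (flatV R n == X)%:R :> int.
Proof.
have [<-|XV] := eqVneq (flatV R n) X.
  rewrite (big_pred1 1%g) ?odd_perm1 // => w /=; rewrite fixflat_le.
  apply/idP/eqP => [/subvP Vw|->]; last first.
    by apply/subvP => x _; apply/mem_fixspace => i; rewrite perm1.
  apply/permP => i; rewrite perm1.
  (* Invariance of the [i]-th unit vector forces [w i = i]. *)
  have /mem_fixspace/(_ i) := Vw (delta_mx 0 i) (memvf _).
  rewrite !mxE !eqxx /=; case: eqP => // _ /eqP.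
  by rewrite eq_sym oner_eq0.
rewrite eq_sym in XV; have [i [j [ij /subvP Xij]]] := flat_sub_hyperplane XV.
set S := \sum_(w | _) _; apply/eqP.
suff : S == - S by rewrite -addr_eq0 -mulr2n mulrn_eq0.
rewrite {1}/S (reindex_inj (mulgI (tperm i j))) -sumrN; apply/eqP.
apply: eq_big => w; last by rewrite odd_mul_tperm ij signr_addb expr1 mulN1r.
rewrite !fixflat_le; apply/subvP/subvP => XF x xX; have := XF x xX;
  have := Xij x xX; rewrite mem_hyperplane => /eqP xij /mem_fixspace xw;
  apply/mem_fixspace => k; last by rewrite permM xw; case: tpermP => [->|->|].
have := xw (tperm i j k); rewrite permM tpermK => ->.
by case: tpermP => [->|->|].
Qed.

(** By [sum_sign_stabilizer], the sums of signs over the permutations with a given fixed space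
    satisfy the recursion defining the Möbius function; induction on the codimension. *)
Lemma mobius_flat X :
  mobius (flatV R n) X = \sum_(w | fixflat w == X) (-1) ^+ odd_perm w.
Proof.
have [m] := ubnP (codim X); elim: m X => // m IH X; rewrite ltnS => Xm.
rewrite mobiusE -sum_sign_stabilizer (bigID (fun w => fixflat w == X)) /=.
rewrite (eq_bigl (fun w => fixflat w == X)) => [|w]; last first.
  by case: eqP => [->|]; rewrite ?lexx ?andbF.
rewrite (eq_bigr (fun Z => \sum_(w | fixflat w == Z) (-1) ^+ odd_perm w));
  last first.
  move=> Z /andP[_ ZX]; apply: IH.
  exact: leq_trans (flat_lt_codim ZX) Xm.
rewrite [X in _ + X - _](partition_big fixflat
  (fun Z => (flatV R n <= Z)%O && (Z < X)%O)) /= => [|w /andP[wX wNX]]; last first.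
  by rewrite flatV_le lt_neqAle wNX wX.
rewrite -[RHS]addr0 -addrA; congr (_ + _); apply/eqP; rewrite subr_eq0.
apply/eqP/eq_bigr => Z /andP[_ ZX]; apply: eq_bigl => w.
have [->|_] := eqVneq (fixflat w) Z; last by rewrite andbF.
by rewrite (ltW ZX) (lt_eqF ZX).
Qed.

(** All permutations with fixed space [X] have reflection length [codim X], hence the same sign:
    nothing cancels. *)
Lemma norm_mobius_flat X :
  `|mobius (flatV R n) X| = \sum_(w | fixflat w == X) 1.
Proof.
rewrite mobius_flat (eq_bigr (fun=> (-1) ^+ codim X * 1)) => [|w /eqP<-].
  rewrite -mulr_sumr normrM normrX normrN1 expr1n mul1r.
  by rewrite ger0_norm // sumr_ge0.
by rewrite codim_fixflat -odd_rlen signr_odd mulr1.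
Qed.

Lemma poin_coefE P k : poin_coef R P k =
  \sum_(w | `[< interior_flat P (fixflat w) >] && (rlen w == k)) 1.
Proof.
rewrite /poin_coef (eq_bigr _ (fun X _ => norm_mobius_flat X)).
rewrite [RHS](partition_big fixflat
  (fun X => `[< interior_flat P X >] && (codim X == k))) /= => [|w].
  apply: eq_bigr => X Xk; apply: eq_bigl => w; rewrite -codim_fixflat.
  by case: eqP => [->|_]; rewrite ?Xk ?andbF.
by rewrite codim_fixflat.
Qed.

Lemma interior_fixflat P w :
  interior_flat P (fixflat w) <-> transverse R P setT w.
Proof.
split=> [[x [/mem_fixspace xw xP]]|[x [xw xP]]].
  by exists (fun i => x 0 i); split=> // i j _ _; apply: xP.
exists (\row_i x i); split; first by apply/mem_fixspace => i; rewrite !mxE xw.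
by move=> i j Pij; rewrite !mxE; apply: xP; rewrite ?inE.
Qed.

Lemma PoinE P : Poin R P = transverse_sum R P setT.
Proof.
rewrite /Poin poly_def /transverse_sum.
rewrite (eq_bigl (fun w => `[< interior_flat P (fixflat w) >])) => [|w]; last first.
  rewrite (asbool_equiv_eq (interior_fixflat P w)) andbC.
  by rewrite (_ : perm_on _ _ = true) ?andbT //; apply/subsetP.
(* Reflection lengths are at most [n], so the polynomial with [n.+1] coefficients loses no term. *)
have lt w : (rlen w < n.+1)%N.
  by rewrite ltnS -[leqRHS](dim_fixspace w) leq_addl.
rewrite (partition_big (fun w => Ordinal (lt w)) xpredT) //=.
apply: eq_bigr => k _; rewrite poin_coefE scaler_suml.
by apply: eq_big => [w|w /andP[_ /eqP <-]]; rewrite ?scale1r // -val_eqE.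
Qed.

End PoincarePolynomial.

(** * Transport of permutations along an injection *)

Section PermTransport.
Variables (T T' : finType) (f : T -> T').
Hypothesis f_inj : injective f.
Implicit Types (u v w : {perm T}).
Local Open Scope group_scope.

Definition transport_fun w (t' : T') : T' :=
  if [pick t | f t == t'] is Some t then f (w t) else t'.

Lemma transport_funE w t : transport_fun w (f t) = f (w t).
Proof.
rewrite /transport_fun; case: pickP => [s /eqP/f_inj->//|/(_ t)].
by rewrite eqxx.
Qed.

Lemma transport_fun_out w t' : t' \notin f @: setT -> transport_fun w t' = t'.
Proof.
move=> t'F; rewrite /transport_fun; case: pickP => // t /eqP tE.
by rewrite -tE imset_f in t'F.
Qed.

Lemma transport_funK w : cancel (transport_fun w) (transport_fun w^-1).
Proof.
move=> t'; have [/imsetP[t _ ->]|t'F] := boolP (t' \in f @: setT).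
  by rewrite !transport_funE permK.
by rewrite !(transport_fun_out _ t'F).
Qed.

Definition transport w : {perm T'} := perm (can_inj (transport_funK w)).

Lemma transportE w t : transport w (f t) = f (w t).
Proof. by rewrite permE transport_funE. Qed.

Lemma transport_out w t' : t' \notin f @: setT -> transport w t' = t'.
Proof. by rewrite permE; apply: transport_fun_out. Qed.

Lemma transport_on w : perm_on (f @: setT) (transport w).
Proof. by apply/subsetP => t'; apply: contraR => /transport_out ->. Qed.

Lemma transport_inj : injective transport.
Proof.
by move=> u v uv; apply/permP => t; apply: f_inj; rewrite -!transportE uv.
Qed.

Lemma transport_tpermM z y u :
  transport (tperm z y * u) = tperm (f z) (f y) * transport u.
Proof.
apply/permP => t'; rewrite permM.
have [/imsetP[t _ ->]|t'F] := boolP (t' \in f @: setT).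
  by rewrite -inj_tperm // !transportE permM.
rewrite tpermD ?transport_out //.
  by apply: contraNneq t'F => <-; rewrite imset_f.
by apply: contraNneq t'F => <-; rewrite imset_f.
Qed.

Lemma rlen_transport w : rlen (transport w) = rlen w.
Proof.
have : perm_on setT w by apply/subsetP.
elim/(@perm_on_ind T setT): w / => [|z y u _ _ zy uz _ IH].
  suff -> : transport 1 = 1 by rewrite !rlen1.
  apply/permP => t'; rewrite perm1.
  have [/imsetP[t _ ->]|/transport_out->//] := boolP (t' \in f @: setT).
  by rewrite transportE perm1.
rewrite transport_tpermM !rlen_tperm ?IH //; first by rewrite transportE uz.
by rewrite (inj_eq f_inj).
Qed.

(** One inclusion is clear; equality follows by counting, since the image of [f] has as many points
    as [T]. *)
Lemma perm_on_transport :
  [set w' : {perm T'} | perm_on (f @: setT) w'] = transport @: setT.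
Proof.
apply/esym/eqP; rewrite eqEcard card_imset ?cardsT; last exact: transport_inj.
apply/andP; split.
  by apply/subsetP => _ /imsetP[w _ ->]; rewrite inE transport_on.
rewrite cardsE card_perm card_imset // -card_perm.
by apply: max_card.
Qed.

End PermTransport.

Lemma transverse_sum_imset (R : realDomainType) (T T' : finType) (f : T -> T')
    (lt : rel T) (lt' : rel T') :
  injective f -> (forall s t, lt' (f s) (f t) = lt s t) ->
  transverse_sum R lt' (f @: setT) = transverse_sum R lt setT.
Proof.
move=> f_inj flt.
rewrite /transverse_sum big_mkcondr /=.
rewrite (eq_bigl (mem (transport f_inj @: setT))) => [|w'] /=; last first.
  by rewrite -perm_on_transport inE.
rewrite big_imset /=; last by move=> u v _ _; apply: transport_inj.
rewrite [RHS]big_mkcondr /=; apply: eq_big => [w|w _].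
  by rewrite inE; apply/esym/subsetP.
rewrite rlen_transport; congr (if _ then _ else _).
apply/asboolP/asboolP => -[x [xw xlt]].
  exists (x \o f); split=> [t|s t _ _ st] /=.
    by rewrite -(transportE f_inj) xw.
  by apply: xlt; rewrite ?imset_f ?flt.
(* Off the image the value 0 is harmless: transported permutations fix those points, and no order
   relation is imposed there. *)
exists (fun t' => if [pick t | f t == t'] is Some t then x t else 0).
have xf t : (if [pick s | f s == f t] is Some s then x s else 0) = x t.
  by case: pickP => [s /eqP/f_inj->//|/(_ t)]; rewrite eqxx.
split=> [t'|_ _ /imsetP[s _ ->] /imsetP[t _ ->]]; last first.
  by rewrite !xf flt => st; apply: xlt; rewrite ?inE.
have [/imsetP[t _ ->]|/transport_out->//] := boolP (t' \in f @: setT).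
by rewrite transportE !xf xw.
Qed.

Lemma transverse_sum_set0 (R : realDomainType) (T : finType) (lt : rel T) :
  transverse_sum R lt set0 = 1.
Proof.
rewrite /transverse_sum (big_pred1 1%g) ?rlen1 // => w /=.
apply/andP/eqP => [[/perm_on_id Hw _]|->]; first by rewrite Hw ?cards0.
split; first exact: perm_on1.
by apply/asboolP; exists (fun=> 0); split=> // s t; rewrite inE.
Qed.

(** * Disjoint unions of chains inside a common grid *)

Section ChainCells.
Variables (R : realType) (l : nat) (a : {ffun 'I_l -> nat}).
Local Notation cell := ('I_l * 'I_(\sum_i a i).+1)%type.
Implicit Types (b : {ffun 'I_l -> nat}) (s t : cell) (S : {set 'I_l}).

(* The chains of all [b] in [below a] live in a common type: [(i, k)] is the
   [k]-th element of the [i]-th chain. *)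
Definition cell_lt : rel cell := fun s t => (s.1 == t.1) && (s.2 < t.2)%N.

Definition cells b : {set cell} := [set t : cell | (t.2 < b t.1)%N].

Lemma lt_sum_cells i k : (k < a i)%N -> (k < (\sum_i a i).+1)%N.
Proof. by move=> ki; rewrite ltnS (bigD1 i) //= ltnW // ltn_addr. Qed.

(** Sending an element to its chain and its position there is an order embedding with image
    [cells b]. *)
Lemma Poin_chains b : b \in below a ->
  Poin R (chains b) = transverse_sum R cell_lt (cells b).
Proof.
move=> /belowP ba; rewrite PoinE.
pose f (u : 'I_(\sum_i b i)) : cell := (tagnat.sig1 u, inord (tagnat.sig2 u)).
have f2 u : val (f u).2 = tagnat.sig2 u.
  apply: inordK; apply: (@lt_sum_cells (tagnat.sig1 u)).
  exact: leq_trans (ltn_ord _) (ba _).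
have f_inj : injective f.
  move=> u v uv; apply: val_inj; rewrite /= (tagnat.rect u) (tagnat.rect v).
  by rewrite -!f2 uv -[tagnat.sig1 u]/(f u).1 uv.
rewrite -(@transverse_sum_imset R _ _ f (plt (chains b)) cell_lt) //; last first.
  move=> u v; rewrite /cell_lt.
  by rewrite -[((f u).2 < _)%N]/(val (f u).2 < val (f v).2)%N !f2.
congr (transverse_sum R _ _); apply/setP => -[i k]; rewrite !inE /=.
apply/imsetP/idP => [[u _ [-> ->]]|ki].
  by have := f2 u => /= ->; apply: ltn_ord.
exists (tagnat.Rank i (Ordinal ki)) => //.
apply: injective_projections; first by rewrite /= tagnat.Rank1K.
by apply: val_inj; rewrite f2 tagnat.Rank2K.
Qed.

Lemma mem_maximals_cells t :
  (t \in maximals cell_lt (cells a)) = (t.2.+1 == a t.1).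
Proof.
case: t => i k; rewrite !inE /=; apply/andP/eqP => [[ki /forall_inP kM]|ki].
  apply/eqP; rewrite eqn_leq ki leqNgt; apply/negP => ki1.
  have := kM (i, inord k.+1); rewrite !inE /cell_lt /= eqxx.
  by rewrite inordK ?(lt_sum_cells ki1) // ltnSn => /(_ ki1).
split; first by rewrite -ki.
apply/forall_inP => -[j m]; rewrite !inE /cell_lt /= => mj.
apply/negP => /andP[/eqP ij km]; move: mj; rewrite -ij -ki ltnS => mk.
by rewrite ltnNge mk in km.
Qed.

Definition indicator S : {ffun 'I_l -> nat} := [ffun i => nat_of_bool (i \in S)].

Lemma indicator_below S :
  (indicator S \in below a) = [forall i in S, 0 < a i]%N.
Proof.
apply/belowP/forall_inP => [Sa i iS|Sa i]; rewrite ?ffunE.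
  by have := Sa i; rewrite ffunE iS.
by case: (boolP (i \in S)) => // /Sa.
Qed.

(** Each nonempty chain has one maximal element, so a set of maximal elements amounts to a set [S]
    of nonempty chains; deleting it shortens each chain in [S] by one. *)
Lemma sum_chains0 : a != 0 ->
  \sum_(S : {set 'I_l} | indicator S \in below a)
    (\prod_(k < #|S|) (k%:R * 'X - 1)) *
      Poin R (chains (subx a (indicator S))) = 0.
Proof.
move=> a0; have A0 : cells a != set0.
  apply: contraNneq a0 => A0; apply/eqP/ffunP => i; rewrite !ffunE.
  apply/eqP; rewrite -leqn0 leqNgt; apply/negP => ai.
  have : (i, ord0) \in cells a by rewrite inE.
  by rewrite A0 inE.
rewrite -[RHS](sum_transverse0 R cell_lt A0); apply/esym.
pose top S : {set cell} := [set t in maximals cell_lt (cells a) | t.1 \in S].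
(* A maximal cell is determined by its chain, which makes [top] and the projection to chains inverse
   to each other. *)
have fst_inj : {in maximals cell_lt (cells a) &, injective fst}.
  move=> [i k] [j m]; rewrite !mem_maximals_cells /= => /eqP ki /eqP mj ij.
  congr (_, _) => //; apply: val_inj; apply: succn_inj.
  by rewrite /= ki mj ij.
rewrite (reindex_onto top (fun B => fst @: B)) /= => [|B /subsetP BM]; last first.
  apply/setP => t; rewrite inE; apply/andP/idP => [[tM /imsetP[s sB ts]]|tB].
    by rewrite (fst_inj _ _ tM (BM s sB) ts).
  by rewrite BM ?imset_f.
have topM S : top S \subset maximals cell_lt (cells a).
  by apply/subsetP => t; rewrite inE => /andP[].
apply: eq_big => [S|S /andP[_ /eqP topS]].
  rewrite topM indicator_below /=; apply/eqP/forall_inP => [<- i|Sa].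
    by case/imsetP => t + ->; rewrite inE mem_maximals_cells => /andP[/eqP<-].
  apply/setP => i; apply/imsetP/idP => [[t + ->]|iS].
    by rewrite inE => /andP[].
  have lt : ((a i).-1 < a i)%N by rewrite prednK ?Sa.
  exists (i, Ordinal (lt_sum_cells lt)) => //.
  by rewrite inE mem_maximals_cells /= iS prednK ?Sa ?eqxx.
have -> : #|S| = #|top S|.
  rewrite -{1}topS card_in_imset // => s t /(subsetP (topM S)) sM.
  by move=> /(subsetP (topM S)) tM; apply: fst_inj.
rewrite Poin_chains ?below_sub //.
congr (_ * transverse_sum R _ _); apply/setP => t.
rewrite in_setD [t \in top S]inE mem_maximals_cells !inE !ffunE.
case: (t.1 \in S); rewrite ?andbF ?subn0 // andbT ltn_subRL add1n.
by rewrite [RHS]ltn_neqAle.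
Qed.

End ChainCells.

(** * Monomials in the power series ring, and the final identity *)

Section PowerSeries.
Variables (l : nat) (A : comNzRingType).
Local Notation S := (mfps l A).
Implicit Types (f g : S) (a b : {ffun 'I_l -> nat}) (c d : A) (J : {set 'I_l}).

Definition mfps_monomial c b : S := MFps (fun a => if a == b then c else 0).

Lemma mcoef_monomialM c b f a :
  (mfps_monomial c b * f) a = if b \in below a then c * f (subx a b) else 0.
Proof.
rewrite [LHS]/=; case: ifP => [ba|ba].
  rewrite (bigD1_seq b) ?below_uniq //= eqxx big1 ?addr0 // => e /negbTE->.
  by rewrite mul0r.
rewrite big_seq big1 // => e ea; case: eqP => [eb|_]; last by rewrite mul0r.
by rewrite -eb ea in ba.
Qed.

Lemma mfps_monomialM c d a b :
  mfps_monomial c a * mfps_monomial d b = mfps_monomial (c * d) (a + b).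
Proof.
apply: mfpsP => e; rewrite mcoef_monomialM /=.
have [ae|ae] := boolP (a \in below e); last first.
  case: eqP => // eab; case/negP: ae; apply/belowP => i.
  by rewrite eab ffunE leq_addr.
have -> : (subx e a == b) = (e == a + b).
  apply/eqP/eqP => [<-|->]; apply/ffunP => i; rewrite !ffunE ?addKn //.
  by apply/esym/subnKC/(belowP _ _ ae).
by case: eqP; rewrite ?mulr0.
Qed.

Lemma prod_mfpsX J : \prod_(i in J) @mfpsX l A i = mfps_monomial 1 (indicator J).
Proof.
have XE i : @mfpsX l A i = mfps_monomial 1 [ffun j => nat_of_bool (j == i)].
  by apply: mfpsP => a /=; case: eqP.
rewrite (eq_bigr _ (fun i _ => XE i)).
have oneE : 1 = mfps_monomial 1 0 :> S by [].
have -> : indicator J = \sum_(i in J) [ffun j => nat_of_bool (j == i)].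
  apply/ffunP => j; rewrite ffunE sum_ffunE.
  under eq_bigr do rewrite ffunE.
  have [jJ|jJ] := boolP (j \in J).
    rewrite (bigD1 j) //= eqxx big1 // => i /andP[_].
    by rewrite eq_sym => /negbTE->.
  by rewrite big1 // => i iJ; case: eqP jJ => // ->; rewrite iJ.
elim/big_rec2: _ => // i a f _ ->.
by rewrite mfps_monomialM mulr1.
Qed.

Lemma mcoef_sum (I : Type) (r : seq I) (P : pred I) (F : I -> S) a :
  (\sum_(i <- r | P i) F i) a = \sum_(i <- r | P i) F i a.
Proof. by elim/big_rec2: _ => // i x f _ <-. Qed.

End PowerSeries.

(** Subsets [J] are grouped by size. The empty one gives the leading 1; for the others the factor at
    [k = 0] is -1, which accounts for the minus sign before the sum. *)
Lemma chain_denominatorE (l : nat) :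
  1 - \sum_(1 <= j < l.+1)
        mfps_esym l {poly int} j *
        mfpsC (\prod_(1 <= k < j) (k%:R * 'X - 1)) =
  \sum_(J : {set 'I_l})
    mfps_monomial (\prod_(k < #|J|) (k%:R * 'X - 1)) (indicator J)
  :> mfps l {poly int}.
Proof.
have ltJ (J : {set 'I_l}) : (#|J| < l.+1)%N.
  by rewrite ltnS -[leqRHS]card_ord max_card.
rewrite [RHS](partition_big (fun J => Ordinal (ltJ J)) xpredT) //=.
rewrite big_ord_recl big_add1 /= big_mkord -sumrN; congr (_ + _).
  rewrite (big_pred1 set0) => [|J]; last by rewrite -val_eqE /= cards_eq0.
  rewrite cards0 big_ord0; apply: mfpsP => a /=.
  suff -> : indicator (set0 : {set 'I_l}) = 0 by [].
  by apply/ffunP => i; rewrite !ffunE inE.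
apply: eq_bigr => j _; rewrite /mfps_esym mulr_suml -sumrN.
apply: eq_big => [J|J /eqP Jj]; first by rewrite -val_eqE.
have CE c : mfpsC c = mfps_monomial c 0 :> mfps l {poly int} by [].
rewrite prod_mfpsX CE mfps_monomialM mul1r addr0 Jj big_ord_recl /=.
rewrite mul0r sub0r mulN1r big_add1 /= big_mkord.
by apply: mfpsP => a /=; case: eqP; rewrite ?oppr0.
Qed.

Theorem theorem1p4 (R : realType) (l : nat) (hl : (0 < l)%N) :
  let D : mfps l {poly int} :=
    1 - \sum_(1 <= j < l.+1)
          mfps_esym l {poly int} j *
          mfpsC (\prod_(1 <= k < j) (k%:R * 'X - 1)) in
  D \is a GRing.unit /\
  MFps (fun a : {ffun 'I_l -> nat} => Poin R (chains a)) = 1 / D.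
Proof.
move=> D; set F := MFps _.
have FD : D * F = 1.
  rewrite /D chain_denominatorE mulr_suml; apply: mfpsP => a.
  rewrite mcoef_sum (eq_bigr _ (fun J _ => mcoef_monomialM _ _ _ a)) /=.
  (* The coefficient is now the sum over the [J] whose indicator is below [a], which vanishes for
     nonzero [a]. *)
  rewrite -big_mkcond /=; have [->|a0] := eqVneq a 0; last exact: sum_chains0.
  (* At [a = 0] only the empty [J] contributes, with the empty poset, whose transverse sum is 1. *)
  rewrite (big_pred1 set0) => [|J].
    rewrite cards0 big_ord0 mul1r (Poin_chains _ (below_sub _ _)).
    rewrite -[RHS](@transverse_sum_set0 R _ (@cell_lt l 0)).
    by congr (transverse_sum R _ _); apply/setP => t; rewrite !inE !ffunE.
  rewrite indicator_below; apply/forall_inP/eqP => [J0|-> i]; last by rewrite inE.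
  by apply/setP => i; rewrite inE; apply/negP => /J0; rewrite ffunE.
have Du : D \is a GRing.unit by apply/unitrPr; exists F.
by split=> //; rewrite -[LHS](mulKr Du) FD mulr1 div1r.
Qed.
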